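(* The set $\Sigma_{1,0,2}^{\mathcal{T}(\mathcal{L}_{\mathsf{T}})}$ of all $\Sigma_{1,0,2}$-sentences in the language $\mathcal{L}_{\mathsf{T}}=\{\perp,\langle\cdot,\cdot\rangle,\sqsubseteq\}$ that are true in $\mathcal{T}(\mathcal{L}_{\mathsf{T}})$ is undecidable. In particular, there is no algorithm that, given a sentence of the form $\exists x\,\forall y\sqsubseteq x\,\forall z\sqsubseteq x\;\phi_0$ with $\phi_0$ quantifier-free, decides whether it is true in $\mathcal{T}(\mathcal{L}_{\mathsf{T}})$.
   Context: Let $\mathbf{H}$ be the set of all variable-free terms built from a constant $\perp$ and a binary function symbol $\langle\cdot,\cdot\rangle$ (finite full binary trees). $\mathcal{T}(\mathcal{L}_{\mathsf{T}})=(\mathbf{H},\perp,\langle\cdot,\cdot\rangle,\sqsubseteq)$ where $\perp$ and $\langle\cdot,\cdot\rangle$ are interpreted as themselves (term algebra) and $\sqsubseteq$ is the subterm relation: $s\sqsubseteq t$ iff $s=t$ or $t=\langle t_1,t_2\rangle$ and $s\sqsubseteq t_1$ or $s\sqsubseteq t_2$. Bounded quantifiers $\exists x\sqsubseteq t\,\phi$, $\forall x\sqsubseteq t\,\phi$ abbreviate $\exists x[x\sqsubseteq t\wedge\phi]$ and $\forall x[x\sqsubseteq t\rightarrow\phi]$. $\Sigma$-formulas are defined inductively: atomic formulas and their negations are $\Sigma$-formulas; if $\phi,\psi$ are $\Sigma$-formulas then so are $\phi\vee\psi$, $\phi\wedge\psi$, $\exists x\sqsubseteq t\,\phi$, $\forall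 x\sqsubseteq t\,\phi$, $\exists x\,\phi$, where $x$ does not occur in the term $t$. A $\Sigma_{n,m,k}$-formula is a $\Sigma$-formula containing $n$ unbounded existential quantifiers, $m$ bounded existential quantifiers and $k$ bounded universal quantifiers; $\Sigma^{\mathfrak A}_{n,m,k}$ denotes the set of $\Sigma_{n,m,k}$-sentences true in $\mathfrak A$. *)

(* Defs.v *)
From Stdlib Require Import Cantor.
From mathcomp Require Import all_boot.

Set Implicit Arguments.
Unset Strict Implicit.
Unset Printing Implicit Defensive.

Inductive term := TVar (x : nat) | TBot | TPair (t u : term).

Inductive form :=
| FEq (t u : term)
| FSub (t u : term)
| FNot (phi : form)
| FAnd (phi psi : form)
| FOr (phi psi : form)
| FImp (phi psi : form)
| FEx (x : nat) (phi : form)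
| FAll (x : nat) (phi : form).

Fixpoint tvars (t : term) : seq nat :=
  match t with
  | TVar x => [:: x]
  | TBot => [::]
  | TPair t u => tvars t ++ tvars u
  end.

Fixpoint free_vars (phi : form) : seq nat :=
  match phi with
  | FEq t u | FSub t u => tvars t ++ tvars u
  | FNot phi => free_vars phi
  | FAnd phi psi | FOr phi psi | FImp phi psi => free_vars phi ++ free_vars psi
  | FEx x phi | FAll x phi => [seq y <- free_vars phi | y != x]
  end.

Definition sentence (phi : form) : Prop := free_vars phi = [::].

Fixpoint quantifier_free (phi : form) : bool :=
  match phi with
  | FEq _ _ | FSub _ _ => true
  | FNot phi => quantifier_free phi
  | FAnd phi psi | FOr phi psi | FImp phi psi =>
      quantifier_free phi && quantifier_free psi
  | FEx _ _ | FAll _ _ => false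
  end.

Definition FBex (x : nat) (t : term) (phi : form) : form :=
  FEx x (FAnd (FSub (TVar x) t) phi).

Definition FBall (x : nat) (t : term) (phi : form) : form :=
  FAll x (FImp (FSub (TVar x) t) phi).

(** [Sigma n m k phi]: [phi] can be built as a Σ-formula using exactly [n]
    unbounded existential, [m] bounded existential and [k] bounded universal
    quantifiers. Bounded quantifiers are abbreviations, so ∃x[x ⊑ t ∧ φ] may be
    counted either as a bounded or as an unbounded existential quantifier. *)
Inductive Sigma : nat -> nat -> nat -> form -> Prop :=
| Sigma_eq t u : Sigma 0 0 0 (FEq t u)
| Sigma_sub t u : Sigma 0 0 0 (FSub t u)
| Sigma_neq t u : Sigma 0 0 0 (FNot (FEq t u))
| Sigma_nsub t u : Sigma 0 0 0 (FNot (FSub t u))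
| Sigma_or n m k n' m' k' phi psi :
    Sigma n m k phi -> Sigma n' m' k' psi ->
    Sigma (n + n') (m + m') (k + k') (FOr phi psi)
| Sigma_and n m k n' m' k' phi psi :
    Sigma n m k phi -> Sigma n' m' k' psi ->
    Sigma (n + n') (m + m') (k + k') (FAnd phi psi)
| Sigma_bex n m k x t phi :
    x \notin tvars t -> Sigma n m k phi -> Sigma n m.+1 k (FBex x t phi)
| Sigma_ball n m k x t phi :
    x \notin tvars t -> Sigma n m k phi -> Sigma n m k.+1 (FBall x t phi)
| Sigma_ex n m k x phi :
    Sigma n m k phi -> Sigma n.+1 m k (FEx x phi).

Record structure := Structure {
  carrier :> Type;
  bot_of : carrier;
  pair_of : carrier -> carrier -> carrier;
  sub_of : carrier -> carrier -> Prop }.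

Section Truth.
Variable A : structure.

Fixpoint tval (s : nat -> A) (t : term) : A :=
  match t with
  | TVar x => s x
  | TBot => bot_of A
  | TPair t u => pair_of (tval s t) (tval s u)
  end.

Definition update (s : nat -> A) (x : nat) (a : A) : nat -> A :=
  fun y => if y == x then a else s y.

Fixpoint sat (s : nat -> A) (phi : form) : Prop :=
  match phi with
  | FEq t u => tval s t = tval s u
  | FSub t u => sub_of (tval s t) (tval s u)
  | FNot phi => ~ sat s phi
  | FAnd phi psi => sat s phi /\ sat s psi
  | FOr phi psi => sat s phi \/ sat s psi
  | FImp phi psi => sat s phi -> sat s psi
  | FEx x phi => exists a, sat (update s x a) phi
  | FAll x phi => forall a, sat (update s x a) phi
  end.

Definition true_in (phi : form) : Prop := forall s, sat s phi.

Definition Sigma_true (n m k : nat) (phi : form) : Prop :=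
  [/\ Sigma n m k phi, sentence phi & true_in phi].

End Truth.

Inductive H := HBot | HPair (t u : H).

Fixpoint subterm (s t : H) : Prop :=
  s = t \/
  match t with
  | HBot => False
  | HPair t1 t2 => subterm s t1 \/ subterm s t2
  end.

Definition term_algebra : structure := Structure HBot HPair subterm.

(** [Sigma 1 0 2 phi] forces negations in the matrix [phi0] to be on atoms. *)
Definition ex_ball_ball (phi : form) : Prop :=
  [/\ Sigma 1 0 2 phi, sentence phi &
      exists x y z phi0, [/\ uniq [:: x; y; z], quantifier_free phi0 &
        phi = FEx x (FBall y (TVar x) (FBall z (TVar x) phi0))]].

Inductive recfun : nat -> Type :=
| RZero n : recfun n
| RSucc : recfun 1
| RProj n (i : 'I_n) : recfun n
| RComp m n (f : recfun m) (g : 'I_m -> recfun n) : recfun n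
| RPrim n (f : recfun n) (g : recfun n.+2) : recfun n.+1
| RMu n (f : recfun n.+1) : recfun n.

(** [prim_graph F G v k b]: the value at (k, v) of the function defined by
    h(0, v) = F(v), h(k+1, v) = G(k, h(k, v), v) is defined and equal to b. *)
Fixpoint prim_graph n (F : n.-tuple nat -> nat -> Prop)
    (G : n.+2.-tuple nat -> nat -> Prop) (v : n.-tuple nat) (k b : nat) : Prop :=
  match k with
  | 0 => F v b
  | k'.+1 => exists2 c, prim_graph F G v k' c & G [tuple of k' :: c :: v] b
  end.

(** [graph f v b]: f(v) is defined and equal to b. *)
Fixpoint graph n (f : recfun n) : n.-tuple nat -> nat -> Prop :=
  match f in recfun n return n.-tuple nat -> nat -> Prop with
  | RZero _ => fun _ b => b = 0
  | RSucc => fun v b => b = (thead v).+1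
  | RProj _ i => fun v b => b = tnth v i
  | RComp m _ f g => fun v b =>
      exists2 w : m.-tuple nat, forall i, graph (g i) v (tnth w i) & graph f w b
  | RPrim _ f g => fun v b =>
      prim_graph (graph f) (graph g) [tuple of behead v] (thead v) b
  | RMu _ f => fun v b =>
      graph f [tuple of b :: v] 0 /\
      forall k, k < b -> exists c, graph f [tuple of k :: v] c.+1
  end.

(** On every n in D, the (possibly elsewhere undefined) function f halts and
    its output, 0 or 1, tells whether A n holds. *)
Definition decides_on (f : recfun 1) (D A : nat -> Prop) : Prop :=
  forall n, D n -> exists2 b : bool, graph f [tuple n] b & (A n <-> b).

Definition recursive (A : nat -> Prop) : Prop :=
  exists f : recfun 1, decides_on f (fun=> True) A.

Definition cpair (m n : nat) : nat := Cantor.to_nat (m, n).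

Fixpoint tcode (t : term) : nat :=
  match t with
  | TVar x => cpair 0 x
  | TBot => cpair 1 0
  | TPair t u => cpair 2 (cpair (tcode t) (tcode u))
  end.

Fixpoint fcode (phi : form) : nat :=
  match phi with
  | FEq t u => cpair 0 (cpair (tcode t) (tcode u))
  | FSub t u => cpair 1 (cpair (tcode t) (tcode u))
  | FNot phi => cpair 2 (fcode phi)
  | FAnd phi psi => cpair 3 (cpair (fcode phi) (fcode psi))
  | FOr phi psi => cpair 4 (cpair (fcode phi) (fcode psi))
  | FImp phi psi => cpair 5 (cpair (fcode phi) (fcode psi))
  | FEx x phi => cpair 6 (cpair x (fcode phi))
  | FAll x phi => cpair 7 (cpair x (fcode phi))
  end.

Lemma cpair_inj m n m' n' : cpair m n = cpair m' n' -> m = m' /\ n = n'.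
Proof. by move=> /Cantor.to_nat_inj [-> ->]. Qed.

Lemma tcode_inj : injective tcode.
Proof.
elim=> [x||t IHt u IHu] [y||t' u'] /cpair_inj [] // _.
- by move=> ->.
- by move=> /cpair_inj [/IHt -> /IHu ->].
Qed.

Lemma fcode_inj : injective fcode.
Proof.
elim=> [t u|t u|p IHp|p IHp q IHq|p IHp q IHq|p IHp q IHq|x p IHp|x p IHp]
  [t' u'|t' u'|p'|p' q'|p' q'|p' q'|x' p'|x' p'] /cpair_inj [] // _;
  try (by move=> /cpair_inj [/tcode_inj -> /tcode_inj ->]);
  try (by move=> /IHp ->);
  try (by move=> /cpair_inj [/IHp -> /IHq ->]);
  by move=> /cpair_inj [-> /IHp ->].
Qed.

Definition codes (P : form -> Prop) (n : nat) : Prop :=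
  exists2 phi, P phi & n = fcode phi.

(* Main.v *)
Require Import Defs.
From mathcomp Require Import all_boot.

Set Implicit Arguments.
Unset Strict Implicit.
Unset Printing Implicit Defensive.

(** A finite tree [x] can serve as a finite set of facts: those trees
    <mark, <k, <id, v>>> that are subterms of [x].  A Horn clause with two
    variables, read as "if the premises are subterms of [x], so is the
    conclusion", is then a matrix for ∀y⊑x ∀z⊑x, so that ∃x∀y⊑x∀z⊑x asks
    whether the set of consequences of finitely many clauses is finite.
    Binary facts suffice to run a recursive function as a dataflow program:
    "argument [j] of the call [id] is [v]", "the result of the call [id] is
    [v]", where a subsidiary call gets the identifier c :: [id]; no clause has
    to mention more than one identifier and one value.  The facts generated by
    a call are finitely many iff the computation terminates, because a
    diverging minimization produces ever longer identifiers.  The input [n]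
    enters through one atom, next to the matrix, so the code of the sentence
    obtained by feeding a matrix its own code is a recursive function of that
    code, and a decision procedure is refuted by diagonalization. *)

(** * Clauses and their closure *)

Definition tag := seq nat.
Definition ident := seq tag.
(** A fact is a kind, a call identifier and a value; the kinds are 0 (called), 1 (result),
    2 (argument 0 is a successor, or the current search value is not a zero)
    and [j.+3] (argument [j]). *)
Definition fact := (nat * ident * nat)%type.
(** In a rule with tag [p], [(k, c, Some d)] stands for the fact [(k, c ++ p :: y, d + z)]
    and [(k, c, None)] for [(k, c ++ p :: y, 0)]; [y] and [z] are the variables of the
    clause. *)
Definition pattern := (nat * ident * option nat)%type.
Definition rule := (tag * seq pattern * pattern)%type.

Definition instance (I : ident) (z : nat) (a : pattern) : fact :=
  (a.1.1, a.1.2 ++ I, if a.2 is Some c then c + z else 0).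

(** A chain of implications, which for a concrete clause computes to a statement that can be applied
    directly. *)
Fixpoint premises (S : fact -> Prop) I z (s : seq pattern) (Q : Prop) : Prop :=
  if s is a :: s' then S (instance I z a) -> premises S I z s' Q else Q.

Definition respects (S : fact -> Prop) I (r : rule) : Prop :=
  forall z, premises S I z r.1.2 (S (instance I z r.2)).

Fixpoint closed_under (S : fact -> Prop) I (rs : seq rule) : Prop :=
  if rs is r :: rs' then respects S I r /\ closed_under S I rs' else True.

(** The head of [I] is the tag and its tail the value of [y], so a rule has instances only at
    identifiers with its own tag. *)
Definition closed_at (R : seq rule) (S : fact -> Prop) (I : ident) : Prop :=
  forall r, r \in R -> ohead I = Some r.1.1 -> respects S I r.

Lemma premisesP S I z s Q :
  premises S I z s Q <-> ((forall a, a \in s -> S (instance I z a)) -> Q).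
Proof.
elim: s => [|a s IH] /=; first by split=> [q _ //|]; apply.
split=> [H hs|H ha].
  have /IH := H (hs a (mem_head _ _)).
  by apply=> b bs; apply: hs; rewrite inE bs orbT.
by apply/IH => hs; apply: H => b; rewrite inE => /predU1P [->|/hs].
Qed.

Lemma closed_underP S I rs :
  closed_under S I rs <-> (forall r, r \in rs -> respects S I r).
Proof.
elim: rs => [|r rs IH] //=; split=> [[hr /IH hrs] s|H].
  by rewrite inE => /predU1P [->|/hrs].
split; first exact/H/mem_head.
by apply/IH => s srs; apply: H; rewrite inE srs orbT.
Qed.

Lemma closed_under_cat S I rs1 rs2 :
  closed_under S I (rs1 ++ rs2) <-> closed_under S I rs1 /\ closed_under S I rs2.
Proof. by elim: rs1 => [|r rs IH] /=; tauto. Qed.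

(** * Clauses attached to each form of recursive function *)

Definition call c : pattern := (0, c, None).
Definition res c z : pattern := (1, c, z).
Definition succ_flag c : pattern := (2, c, None).
Definition arg j c z : pattern := (j.+3, c, z).

Definition pass p guard n a b c : seq rule :=
  [seq (p, rcons guard (arg (a + j) [::] (Some 0)), arg (b + j) c (Some 0))
     | j <- iota 0 n].

Lemma closed_pass S I p guard n a b c :
  closed_under S I (pass p guard n a b c) <->
  forall j z, j < n -> premises S I z guard
    (S ((a + j).+3, I, z) -> S ((b + j).+3, c ++ I, z)).
Proof.
have E s z P Q : premises S I z (rcons s P) Q <->
    premises S I z s (S (instance I z P) -> Q).
  by elim: s => [|t s IH] //=; split=> h /h /IH.
rewrite closed_underP; split=> [H j z jn|H r /mapP [j]].
  apply/(E guard z (arg (a + j) [::] (Some 0))); apply: (H (p, _, arg (b + j) c (Some 0))).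
  by apply/mapP; exists j; rewrite ?mem_iota.
by rewrite mem_iota => /(H j) h -> z; apply/E/h.
Qed.

Definition zero_rules p : seq rule := [:: (p, [:: call [::]], res [::] None)].

Definition succ_rules p : seq rule :=
  [:: (p, [:: arg 0 [::] (Some 0)], res [::] (Some 1))].

Definition proj_rules i p : seq rule :=
  [:: (p, [:: arg i [::] (Some 0)], res [::] (Some 0))].

(** The outer function runs as the call [0 :: p] and the inner function [k] as [k.+1 :: p], whose
    result becomes argument [k] of the former. *)
Definition comp_rules m n p : seq rule :=
  [:: (p, [:: call [::]], call [:: 0 :: p]);
      (p, [:: res [:: 0 :: p] (Some 0)], res [::] (Some 0))] ++
  flatten [seq
    [:: (p, [:: call [::]], call [:: k.+1 :: p]);
        (p, [:: res [:: k.+1 :: p] (Some 0)], arg k [:: 0 :: p] (Some 0))] ++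
    pass p [::] n 0 0 [:: k.+1 :: p] | k <- iota 0 m].

(** The predecessor stage of the recursion is the subsidiary call [p :: p :: y]. *)
Definition prim_rules n p : seq rule :=
  [:: (p, [:: arg 0 [::] None], call [:: 0 :: p]);
      (p, [:: res [:: 0 :: p] (Some 0)], res [::] (Some 0));
      (p, [:: arg 0 [::] (Some 1)], succ_flag [::]);
      (p, [:: arg 0 [::] (Some 1)], call [:: p]);
      (p, [:: arg 0 [::] (Some 1)], arg 0 [:: p] (Some 0));
      (p, [:: arg 0 [::] (Some 1)], call [:: 1 :: p]);
      (p, [:: arg 0 [::] (Some 1)], arg 0 [:: 1 :: p] (Some 0));
      (p, [:: res [:: p] (Some 0)], arg 1 [:: 1 :: p] (Some 0));
      (p, [:: res [:: 1 :: p] (Some 0)], res [::] (Some 0))] ++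
  pass p [:: arg 0 [::] None] n 1 0 [:: 0 :: p] ++
  pass p [:: succ_flag [::]] n 1 1 [:: p] ++
  pass p [:: succ_flag [::]] n 1 2 [:: 1 :: p].

(** The search is the call [1 :: p] with 0 as extra first argument; the tag [0 :: p] is left for the
    minimized function, which the search calls. *)
Definition mu_rules n p : seq rule :=
  [:: (p, [:: call [::]], call [:: 1 :: p]);
      (p, [:: call [::]], arg 0 [:: 1 :: p] None);
      (p, [:: res [:: 1 :: p] (Some 0)], res [::] (Some 0))] ++
  pass p [::] n 0 1 [:: 1 :: p].

(** A call [q :: y] with arguments [k :: v] searches for the least zero from [k] on;
    the search from [k.+1] is the subsidiary call [q :: q :: y]. *)
Definition loop_rules n c q : seq rule :=
  [:: (q, [:: call [::]], call [:: c]);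
      (q, [:: res [:: c] None; arg 0 [::] (Some 0)], res [::] (Some 0));
      (q, [:: res [:: c] (Some 1)], succ_flag [::]);
      (q, [:: succ_flag [::]], call [:: q]);
      (q, [:: succ_flag [::]; arg 0 [::] (Some 0)], arg 0 [:: q] (Some 1));
      (q, [:: res [:: q] (Some 0)], res [::] (Some 0))] ++
  pass q [::] n.+1 0 0 [:: c] ++
  pass q [:: succ_flag [::]] n 1 1 [:: q].

Fixpoint compile n (f : recfun n) (p : tag) : seq rule :=
  match f with
  | RZero _ => zero_rules p
  | RSucc => succ_rules p
  | RProj _ i => proj_rules i p
  | RComp m n f g => comp_rules m n p ++ compile f (0 :: p) ++
      flatten [seq compile (g k) (k.+1 :: p) | k : 'I_m]
  | RPrim n f g => prim_rules n p ++ compile f (0 :: p) ++ compile g (1 :: p)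
  | RMu n f => mu_rules n p ++ loop_rules n (0 :: p) (1 :: p) ++
      compile f (0 :: p)
  end.

(** Both inclusions count: the presence of the rules drives a computation on, and the absence of
    others with this tag keeps a finite trace closed. *)
Definition has_rules (R : seq rule) (p : tag) (rs : seq rule) : Prop :=
  forall r, (r \in rs) = (r \in R) && (r.1.1 == p).

(** [R] stays that of the whole program while [f] descends to its parts, so inductions on [f] can
    keep one closed set. *)
Fixpoint loaded (R : seq rule) n (f : recfun n) (p : tag) : Prop :=
  match f with
  | RZero _ => has_rules R p (zero_rules p)
  | RSucc => has_rules R p (succ_rules p)
  | RProj _ i => has_rules R p (proj_rules i p)
  | RComp m n f g => [/\ has_rules R p (comp_rules m n p),
      loaded R f (0 :: p) & forall k, loaded R (g k) (k.+1 :: p)]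
  | RPrim n f g => [/\ has_rules R p (prim_rules n p),
      loaded R f (0 :: p) & loaded R g (1 :: p)]
  | RMu n f => [/\ has_rules R p (mu_rules n p),
      has_rules R (1 :: p) (loop_rules n (0 :: p) (1 :: p)) &
      loaded R f (0 :: p)]
  end.

Lemma closed_atE R S p y rs : has_rules R p rs ->
  closed_at R S (p :: y) <-> closed_under S (p :: y) rs.
Proof.
move=> hR; rewrite closed_underP; split=> H r.
  by rewrite hR => /andP [rR /eqP rp]; apply: H; rewrite ?rp.
by move=> rR [rp]; apply: H; rewrite hR rR rp eqxx.
Qed.

Definition inputs (S : fact -> Prop) (I : ident) (v : seq nat) : Prop :=
  S (0, I, 0) /\ forall j, j < size v -> S (j.+3, I, nth 0 v j).

(** * Finite closed sets force termination *)

Section Halting.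
Variables (R : seq rule) (S : fact -> Prop) (N : nat).
Hypothesis S_closed : forall I, closed_at R S I.
Hypothesis S_bounded : forall k I z, S (k, I, z) -> size I <= N.

Let S_under p y rs (hR : has_rules R p rs) : closed_under S (p :: y) rs.
Proof. exact/(closed_atE _ _ hR)/S_closed. Qed.

(** Induction on [f]: closure carries the arguments to each subsidiary call and its result back.
    Only minimization can run forever, and there each further step lengthens the identifier, which
    [S_bounded] stops. *)
Lemma closed_halts n (f : recfun n) (p : tag) : loaded R f p ->
  forall (y : ident) (v : n.-tuple nat), inputs S (p :: y) v ->
  exists2 b, graph f v b & S (1, p :: y, b).
Proof.
elim: f p => {n}.
- move=> n p /= hR y v [h0 _]; exists 0 => //.
  by have [/(_ 0 h0)] := S_under y hR.
- move=> p /= hR y v [_ h]; exists (thead v).+1 => //.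
  have [/(_ (thead v))] := S_under y hR.
  by move=> H0 _; apply: H0; rewrite /thead (tnth_nth 0); apply: h; rewrite size_tuple.
- move=> n i p /= hR y v [_ h]; exists (tnth v i) => //.
  have [/(_ (tnth v i))] := S_under y hR.
  by move=> H0 _; apply: H0; rewrite /instance /= (tnth_nth 0); apply: h; rewrite size_tuple.
- move=> m n f IHf g IHg p /= [hR lf lg] y v [h0 h].
  have [hc [hr /closed_underP hfl]] := S_under y hR.
  have {}hfl k : k < m -> [/\ S (0, [:: k.+1 :: p, p & y], 0),
     forall z, S (1, [:: k.+1 :: p, p & y], z) -> S (k.+3, [:: 0 :: p, p & y], z) &
     forall j, j < n -> S (j.+3, [:: k.+1 :: p, p & y], nth 0 v j)].
    move=> km; have /closed_underP : forall r, r \in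
        [:: (p, [:: call [::]], call [:: k.+1 :: p]);
        (p, [:: res [:: k.+1 :: p] (Some 0)], arg k [:: 0 :: p] (Some 0))] ++
        pass p [::] n 0 0 [:: k.+1 :: p] -> respects S (p :: y) r.
      move=> r hk; apply: hfl; apply/flatten_mapP; exists k => //.
      by rewrite mem_iota.
    move=> [/(_ 0 h0) H1 [H2 /closed_pass H3]]; split=> // j jn.
    by apply: (H3 j _ jn); apply: h; rewrite size_tuple.
  have /fin_all_exists2 [w hw Sw] : forall k : 'I_m, exists2 b,
      graph (g k) v b & S (1, [:: k.+1 :: p, p & y], b).
    move=> k; apply: IHg; first exact: lg.
    have [H1 _ H3] := hfl k (ltn_ord k); split=> // j.
    by rewrite size_tuple; apply: H3.
  have [|b hb Sb] := IHf _ lf (p :: y) [tuple w k | k < m].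
    split; first exact: (hc 0 h0).
    move=> j; rewrite size_tuple => jm.
    have [_ H2 _] := hfl j jm; apply: H2.
    by have := Sw (Ordinal jm); rewrite -[j]/(val (Ordinal jm)) -tnth_nth tnth_mktuple.
  exists b; last exact: hr b Sb.
  by exists [tuple w k | k < m] => // k; rewrite tnth_mktuple.
- move=> n f IHf g IHg p /= [hR lf lg] y v.
  case/tupleP: v => k v; rewrite theadE.
  have -> : [tuple of behead [tuple of k :: v]] = v by exact: val_inj.
  (* [y] varies because the stage for [k] is a call one level deeper, at [p :: p :: y]. *)
  elim: k y => [|k IHk] y [h0 h];
    have [r1 [r2 [r3 [r4 [r5 [r6 [r7 [r8 [r9 /closed_under_cat [/closed_pass g1
      /closed_under_cat [/closed_pass g2 /closed_pass g3]]]]]]]]]]] :=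
      S_under y hR;
    have hv j : j < n -> S (j.+4, p :: y, nth 0 v j)
      by move=> jn; apply: (h j.+1); rewrite /= size_tuple.
    have [|b hb Sb] := IHf _ lf (p :: y) v; last by exists b => //; exact: r2 Sb.
    split; first exact: (r1 0 (h 0 isT)).
    by move=> j; rewrite size_tuple => jn; apply: (g1 j _ jn (h 0 isT) (hv j jn)).
  have hk : S (3, p :: y, 1 + k) by exact: (h 0 isT).
  have hs : S (2, p :: y, 0) by exact: (r3 k hk).
  have [|c hc Sc] := IHk (p :: y).
    split; first exact: (r4 k hk).
    case=> [|j]; first by move=> _; exact: (r5 k hk).
    by rewrite /= ltnS size_tuple => jn; apply: (g2 j _ jn hs (hv j jn)).
  have [|b hb Sb] := IHg _ lg (p :: y) [tuple of k :: c :: v]; last first.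
    by exists b; [exists c|exact: r9 Sb].
  split; first exact: (r6 k hk).
  case=> [|[|j]]; [by move=> _; exact: (r7 k hk)|by move=> _; exact: (r8 c Sc)|].
  by rewrite /= !ltnS size_tuple => jn; apply: (g3 j _ jn hs (hv j jn)).
move=> n f IHf p /= [hR hL lf] y v [h0 h].
have [r1 [r2 [r3 /closed_pass g1]]] := S_under y hR.
(* [d] is the room left for longer identifiers; at 0 the call itself has length [N.+1]. The last
   premise records that no value below [k] is a zero. *)
suff loop d : forall k y', inputs S ((1 :: p) :: y') (k :: v) ->
    size y' + d = N -> (forall j, j < k -> exists c, graph f [tuple of j :: v] c.+1) ->
    exists2 b, graph f [tuple of b :: v] 0 /\
      (forall j, j < b -> exists c, graph f [tuple of j :: v] c.+1) &
      S (1, (1 :: p) :: y', b).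
  have [||//|b hb Sb] := loop (N - size (p :: y)) 0 (p :: y); last by exists b => //; exact: r3 Sb.
    split; first exact: (r1 0 h0).
    case=> [|j]; first by move=> _; exact: (r2 0 h0).
    by rewrite /= ltnS => jn; apply: (g1 j _ _ (h j jn)); rewrite -(size_tuple v).
  by rewrite subnKC // (S_bounded h0).
elim: d => [|d IHd] k y' hin.
  by rewrite addn0 => E _; have := S_bounded hin.1; rewrite /= E ltnn.
move=> E hk; have [h0' h'] := hin.
have /closed_under_cat [[s1 [s2 [s3 [s4 [s5 [s6 _]]]]]]
  /closed_under_cat [/closed_pass t1 /closed_pass t2]] := S_under y' hL.
have [|[|c] hc Sc] := IHf _ lf ((1 :: p) :: y') [tuple of k :: v].
- split; first exact: (s1 0 h0').
  move=> j hj; apply: (t1 j _ _ (h' j hj)).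
  by rewrite -[n.+1](size_tuple [tuple of k :: v]).
- by exists k => //; exact: (s2 k Sc (h' 0 isT)).
have hs : S (2, (1 :: p) :: y', 0) by exact: (s3 c Sc).
have [||j|b hb Sb] := IHd k.+1 ((1 :: p) :: y').
- split; first exact: (s4 0 hs).
  case=> [|j]; first by move=> _; exact: (s5 k hs (h' 0 isT)).
  by move=> hj; apply: (t2 j _ _ hs (h' j.+1 hj)); rewrite -(size_tuple v).
- by rewrite /= addSnnS.
- by rewrite ltnS leq_eqVlt => /predU1P [->|/hk //]; exists c.
by exists b => //; exact: s6 Sb.
Qed.

End Halting.

(** * Terminating computations have finite traces *)

(** Subsidiary calls prolong the identifier on the left, so the facts of one call live in
    the cone of its identifier, and those of distinct subsidiary calls in disjoint cones. *)
Definition cone (I : ident) (X : seq fact) : Prop :=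
  forall a, a \in X -> suffix I a.1.2.

Definition cone_closed (R : seq rule) (I : ident) (X : seq fact) : Prop :=
  forall I', suffix I I' -> closed_at R (fun a => a \in X) I'.

Definition own_facts (I : ident) (v : seq nat) (b : nat) (flag : bool) : seq fact :=
  (0, I, 0) :: (1, I, b) :: (if flag then [:: (2, I, 0)] else [::]) ++
  [seq (j.+3, I, nth 0 v j) | j <- iota 0 (size v)].

Definition join (I : ident) v b flag (T : seq tag) (Xs : tag -> seq fact) :=
  own_facts I v b flag ++ flatten [seq Xs c | c <- T].

(** Closure is required only for the rules whose [p :: y] lies in the cone of [I]: the result
    fact of [I] may still trigger a rule of the calling [behead I]. *)
Record trace R (I : ident) (v : seq nat) (b : nat) (X : seq fact) : Prop := Trace {
  trace_inputs : inputs (fun a => a \in X) I v;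
  trace_result : forall z, (1, I, z) \in X -> z = b;
  trace_cone : cone I X;
  trace_closed : cone_closed R I X }.

(** Both [c :: I] and [d :: I] are final segments of one list and have equal length. This makes the
    cones of distinct subsidiary calls disjoint. *)
Lemma suffix_cons_cat (T : eqType) (c d : T) (I l : seq T) :
  suffix (c :: I) (l ++ d :: I) -> c = d.
Proof.
move=> /suffixP [s]; rewrite -!cat_rcons => E.
have /eqP := E; rewrite eqseq_cat ?eqxx ?andbT; last first.
  by move/(congr1 size): E; rewrite !size_cat => /addIn.
by move=> /eqP /rcons_inj [].
Qed.

Section Join.
Variables (R : seq rule) (p : tag) (y : ident) (rs : seq rule).
Hypothesis R_premised : forall r, r \in R -> r.1.2 != [::].
Hypothesis R_rules : has_rules R p rs.
Variables (v : seq nat) (b : nat) (flag : bool) (T : seq tag) (Xs : tag -> seq fact).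
Let I : ident := p :: y.
Let X := join I v b flag T Xs.
Variables (vs : tag -> seq nat) (bs : tag -> nat).
Hypothesis Xs_trace : forall c, c \in T -> trace R (c :: I) (vs c) (bs c) (Xs c).

Lemma own_id a : a \in own_facts I v b flag -> a.1.2 = I.
Proof.
rewrite !inE mem_cat => /or3P [/eqP ->|/eqP ->|/orP [|/mapP [j _ ->]]] //.
by case: flag; rewrite // inE => /eqP ->.
Qed.

(** Own facts have too short an identifier, and the cones of other children are disjoint from that
    of [c]. *)
Lemma join_child k l c z : (k, l ++ c :: I, z) \in X ->
  c \in T /\ (k, l ++ c :: I, z) \in Xs c.
Proof.
rewrite mem_cat => /orP [/own_id /= /(congr1 size)|/flatten_mapP [d dT dX]].
  by rewrite size_cat /= => E; have := leq_addl (size l) (size y).+2; rewrite E ltnn.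
have := trace_cone (Xs_trace dT) dX => /suffix_cons_cat E.
by move: dT dX; rewrite E.
Qed.

Lemma join_own k z : (k, I, z) \in X -> (k, I, z) \in own_facts I v b flag.
Proof.
rewrite mem_cat => /orP [//|/flatten_mapP [d dT dX]].
by have := trace_cone (Xs_trace dT) dX => /size_suffix /=; rewrite ltnn.
Qed.

Lemma join_call : (0, I, 0) \in X. Proof. by rewrite !inE eqxx. Qed.
Lemma join_res : (1, I, b) \in X. Proof. by rewrite !inE eqxx orbT. Qed.
Lemma join_flag : flag -> (2, I, 0) \in X.
Proof. by rewrite !inE !mem_cat => ->; rewrite inE eqxx !orbT. Qed.
Lemma join_arg j : j < size v -> (j.+3, I, nth 0 v j) \in X.
Proof.
move=> jn; rewrite !inE !mem_cat; apply/orP; right; apply/orP; right; apply/orP; left.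
by apply/orP; right; apply/mapP; exists j; rewrite ?mem_iota.
Qed.

Lemma joinP k z : (k, I, z) \in X ->
  match k with
  | 0 => z = 0
  | 1 => z = b
  | 2 => flag
  | j.+3 => j < size v /\ z = nth 0 v j
  end.
Proof.
move/join_own; rewrite !inE mem_cat => /or3P [/eqP [-> ->]|/eqP [-> ->]|/orP []] //.
  by case: flag; rewrite // inE => /eqP [-> _].
by move=> /mapP [j]; rewrite mem_iota => jn [-> ->].
Qed.

Lemma join_childX c a : c \in T -> a \in Xs c -> a \in X.
Proof. by move=> cT aX; rewrite mem_cat; apply/orP; right; apply/flatten_mapP; exists c. Qed.

Lemma join_child_res c z : (1, c :: I, z) \in X -> c \in T /\ z = bs c.
Proof. by move=> /(@join_child _ [::]) [cT /(trace_result (Xs_trace cT))]. Qed.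

Lemma join_child_call c : c \in T -> (0, c :: I, 0) \in X.
Proof. by move=> cT; apply: (join_childX cT); case: (trace_inputs (Xs_trace cT)). Qed.

Lemma join_child_arg c j z : c \in T -> j < size (vs c) -> z = nth 0 (vs c) j ->
  (j.+3, c :: I, z) \in X.
Proof.
move=> cT jn ->; apply: (join_childX cT).
by case: (trace_inputs (Xs_trace cT)) => _; apply.
Qed.

(** Only the rules at [I] itself need checking. Deeper down a rule has a premise, which places the
    identifier in the cone of one child; all its premises then come from the trace of that child,
    which is closed. *)
Lemma join_trace : closed_under (fun a => a \in X) I rs -> trace R I v b X.
Proof.
move=> Xcl; split.
- by split; [exact: join_call|exact: join_arg].
- by move=> z /joinP.
- move=> a; rewrite mem_cat => /orP [/own_id ->|/flatten_mapP [c cT ca]].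
    exact: suffix_refl.
  by apply: suffix_trans (trace_cone (Xs_trace cT) ca); exact: suffix_cons.
move=> I' /suffixP [s ->]; case: (lastP s) => [|l c].
  exact/(closed_atE _ _ R_rules).
rewrite cat_rcons => r rR rI z; apply/premisesP => H.
have pre a : a \in r.1.2 -> c \in T /\ instance (l ++ c :: I) z a \in Xs c.
  by move/H; rewrite /instance catA => /join_child.
have cT : c \in T.
  case: (r.1.2) (R_premised rR) pre => // a s' _ /(_ a (mem_head _ _)) [//].
apply: (join_childX cT).
have := trace_closed (Xs_trace cT) (suffix_suffix _ _) rR rI z.
by move=> /premisesP; apply=> a /pre [].
Qed.

End Join.

Arguments join_child_call [R p y v b flag T Xs vs bs] Xs_trace [c] _.
Arguments join_child_arg [R p y v b flag T Xs vs bs] Xs_trace [c j z] _ _ _.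

Lemma label_neq (k : nat) (p : tag) : (k :: p == p) = false.
Proof. by apply/eqP => /(congr1 size) /= /esym /n_Sn. Qed.

(** Induction on [f], with [join] at each call: a defined value rests on finitely many subsidiary
    values, each with a trace of its own. *)
Lemma traced R n (f : recfun n) (p : tag) :
  (forall r, r \in R -> r.1.2 != [::]) -> loaded R f p ->
  forall (y : ident) (v : n.-tuple nat) b, graph f v b ->
  exists X, trace R (p :: y) v b X.
Proof.
move=> Rp; elim: f p => {n}.
- move=> n p /= hR y v _ ->; exists (join (p :: y) v 0 false [::] (fun=> [::])).
  apply: (join_trace (vs := fun=> [::]) (bs := fun=> 0) Rp hR) => //; split=> // z _.
  exact: join_res.
- move=> p /= hR y v _ ->.
  exists (join (p :: y) v (thead v).+1 false [::] (fun=> [::])).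
  have tr c : c \in [::] -> trace R (c :: p :: y) [::] 0 [::] by [].
  apply: (join_trace Rp hR tr); split=> // z /(joinP tr) [_ E].
  by rewrite /instance /= [z]E /thead (tnth_nth 0); exact: join_res.
- move=> n i p /= hR y v _ ->.
  exists (join (p :: y) v (tnth v i) false [::] (fun=> [::])).
  have tr c : c \in [::] -> trace R (c :: p :: y) [::] 0 [::] by [].
  apply: (join_trace Rp hR tr); split=> // z /(joinP tr) [_ E].
  by rewrite /instance /= [z]E (tnth_nth 0); exact: join_res.
- move=> m n f IHf g IHg p /= [hR lf lg] y v b [w hw hb].
  have [Xf trf] := IHf _ lf (p :: y) _ _ hb.
  have /fin_all_exists [G trG] : forall k : 'I_m, exists X,
      trace R [:: k.+1 :: p, p & y] v (tnth w k) X.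
    by move=> k; apply: IHg (lg k) _ _ _ (hw k).
  pose T := (0 :: p) :: [seq k.+1 :: p | k <- iota 0 m].
  (* The first entry of a child's tag tells which function it runs: 0 the outer one, [k.+1] the
     inner function [k]. *)
  pose pick_child A (a0 : A) (a1 : nat -> A) (c : tag) : A :=
    if head 0 c is k.+1 then a1 k else a0.
  pose Xs := pick_child _ Xf (fun k => oapp G [::] (insub k)).
  pose vs := pick_child _ (val w) (fun=> val v).
  pose bs := pick_child _ b (nth 0 w).
  have tr c : c \in T -> trace R [:: c, p & y] (vs c) (bs c) (Xs c).
    rewrite inE => /predU1P [->|/mapP [k]]; first exact: trf.
    rewrite mem_iota => /= km ->; rewrite /vs /bs /Xs /pick_child /=.
    by rewrite insubT /= -[k]/(val (Ordinal km)) -tnth_nth; exact: trG.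
  have T0 : 0 :: p \in T by exact: mem_head.
  have Tk k : k < m -> k.+1 :: p \in T.
    by move=> km; rewrite inE; apply/orP/or_intror/mapP; exists k; rewrite ?mem_iota.
  exists (join (p :: y) v b false T Xs); apply: (join_trace Rp hR tr).
  split; first by move=> z _; exact: (join_child_call tr T0).
  split; first by move=> z /(join_child_res tr) [_ E]; rewrite /instance /= [z]E; exact: join_res.
  apply/closed_underP => r /flatten_mapP [k]; rewrite mem_iota => /= km; move: r.
  apply/closed_underP; split; first by move=> z _; apply: (join_child_call tr (Tk k km)).
  split.
    move=> z /(join_child_res tr) [_ E]; apply: (join_child_arg tr T0); last exact: E.
    by rewrite /vs /= size_tuple.
  apply/closed_pass => j z jn /(joinP tr) [_ E].
  apply: (join_child_arg tr (Tk k km)); last exact: E.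
  by rewrite /vs /= size_tuple.
- move=> n f IHf g IHg p /= [hR lf lg] y v b.
  case/tupleP: v => k v; rewrite theadE.
  have -> : [tuple of behead [tuple of k :: v]] = v by exact: val_inj.
  elim: k y b => [|k IHk] y b /=.
    move=> hb; have [Xf trf] := IHf _ lf (p :: y) _ _ hb.
    have tr c : c \in [:: 0 :: p] -> trace R (c :: p :: y) v b Xf.
      by rewrite inE => /eqP ->.
    have T0 : 0 :: p \in [:: 0 :: p] by exact: mem_head.
    (* With recursion argument 0 only [0 :: p] is called; the clauses reading results of [p] or
       [1 :: p] hold vacuously, as these are not children. *)
    exists (join (p :: y) (0 :: v) b false [:: 0 :: p] (fun=> Xf)).
    apply: (join_trace Rp hR tr).
    do 9?split; try by move=> z /(joinP tr) [].
    + by move=> z _; exact: (join_child_call tr).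
    + by move=> z /(join_child_res tr) [_ E]; rewrite /instance /= [z]E; exact: join_res.
    + by move=> z /(join_child_res tr) []; rewrite inE eq_sym label_neq.
    + by move=> z /(join_child_res tr) []; rewrite inE eqseq_cons.
    apply/(closed_under_cat _ _ (pass _ _ _ _ _ _)); split;
      last (apply/closed_under_cat; split);
      apply/closed_pass => j z jn /(joinP tr) // _.
    by move=> /(joinP tr) [_ E]; apply: (join_child_arg tr); rewrite ?size_tuple.
  move=> [c hc hb].
  have [Xr trr] := IHk (p :: y) _ hc; have [Xg trg] := IHg _ lg (p :: y) _ _ hb.
  pose Xs d := if d == p then Xr else Xg.
  pose vs d := if d == p then k :: v else k :: c :: v.
  pose bs d := if d == p then c else b.
  pose T := [:: p; 1 :: p].
  have tr d : d \in T -> trace R (d :: p :: y) (vs d) (bs d) (Xs d).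
    by rewrite /vs /bs /Xs !inE => /orP [] /eqP ->; rewrite ?eqxx ?label_neq.
  have Tr : p \in T by exact: mem_head.
  have Tg : 1 :: p \in T by rewrite !inE eqxx orbT.
  have vr : vs p = k :: v by rewrite /vs eqxx.
  have vg : vs (1 :: p) = k :: c :: v by rewrite /vs label_neq.
  (* Now the children are the predecessor stage [p] and the step function [1 :: p], and the flag
     lets [v] pass to both. *)
  exists (join (p :: y) (k.+1 :: v) b true T Xs).
  apply: (join_trace Rp hR tr).
  do 9?split; try by move=> z /(joinP tr) [].
  + by move=> z /(join_child_res tr) []; rewrite !inE label_neq eqseq_cons.
  + by move=> z _; exact: join_flag.
  + by move=> z _; exact: (join_child_call tr).
  + by move=> z /(joinP tr) [_ [E]]; apply: (join_child_arg tr Tr); rewrite vr.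
  + by move=> z _; exact: (join_child_call tr).
  + by move=> z /(joinP tr) [_ [E]]; apply: (join_child_arg tr Tg); rewrite vg.
  + move=> z /(join_child_res tr) [_ E]; apply: (join_child_arg tr Tg); rewrite vg //.
    by move: E; rewrite /bs eqxx.
  + move=> z /(join_child_res tr) [_ E]; rewrite /instance /= [z]E /bs label_neq.
    exact: join_res.
  apply/(closed_under_cat _ _ (pass _ _ _ _ _ _)); split;
      last (apply/closed_under_cat; split);
    apply/closed_pass => j z jn /(joinP tr).
  + by case.
  + by move=> _ /(joinP tr) [_ E]; apply: (join_child_arg tr Tr); rewrite vr //= size_tuple.
  + by move=> _ /(joinP tr) [_ E]; apply: (join_child_arg tr Tg); rewrite vg //= size_tuple.
move=> n f IHf p /= [hR hL lf] y v b [hb hlt].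
(* Built backwards from the zero [b]: [d] is the number of search steps left, and every stage
   returns the same [b]. *)
suff loop d : forall k y', k + d = b ->
    exists X, trace R ((1 :: p) :: y') (k :: v) b X.
  have [X0 tr0] := loop b 0 (p :: y) (add0n b).
  pose T := [:: 1 :: p].
  have tr c : c \in T -> trace R (c :: p :: y) (0 :: v) b X0.
    by rewrite inE => /eqP ->.
  have Tq : 1 :: p \in T by exact: mem_head.
  exists (join (p :: y) v b false T (fun=> X0)); apply: (join_trace Rp hR tr).
  do 3?split.
  + by move=> z _; exact: (join_child_call tr).
  + by move=> z _; exact: (join_child_arg tr Tq).
  + by move=> z /(join_child_res tr) [_ E]; rewrite /instance /= [z]E; exact: join_res.
  apply/closed_pass => j z jn /(joinP tr) [_ E].
  by apply: (join_child_arg tr Tq) => //=; rewrite size_tuple.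
elim: d => [|d IHd] k y'; [rewrite addn0 => E | rewrite addnS => E].
  have [Xf trf] := IHf _ lf ((1 :: p) :: y') _ _ hb.
  pose T := [:: 0 :: p].
  have tr c : c \in T -> trace R [:: c, 1 :: p & y'] (k :: v) 0 Xf.
    by rewrite inE E => /eqP ->.
  have T0 : 0 :: p \in T by exact: mem_head.
  exists (join ((1 :: p) :: y') (k :: v) b false T (fun=> Xf)); apply: (join_trace Rp hL tr).
  apply/closed_under_cat; split; last (apply/closed_under_cat; split).
  - do 7?split; try by move=> z /(joinP tr).
    + by move=> z _; exact: (join_child_call tr).
    + by move=> z _ /(joinP tr) [_ Ez]; rewrite /instance /= [z]Ez /= E; exact: join_res.
    + by move=> z /(join_child_res tr) [_].
    + by move=> z /(join_child_res tr) []; rewrite inE eqseq_cons.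
  - apply/closed_pass => j z jn /(joinP tr) [_ Ez]; apply: (join_child_arg tr T0) => //=.
    by rewrite size_tuple.
  - by apply/closed_pass => j z jn /(joinP tr).
have [Xr trr] := IHd k.+1 ((1 :: p) :: y') E.
have [|a ha] := hlt k; first by rewrite -E ltnS leq_addr.
have [Xf trf] := IHf _ lf ((1 :: p) :: y') _ _ ha.
pose T := [:: 0 :: p; 1 :: p].
pose Xs d := if d == 0 :: p then Xf else Xr.
pose vs d := if d == 0 :: p then k :: v else k.+1 :: v.
pose bs d := if d == 0 :: p then a.+1 else b.
have tr c : c \in T -> trace R [:: c, 1 :: p & y'] (vs c) (bs c) (Xs c).
  by rewrite /vs /bs /Xs !inE => /orP [] /eqP ->; rewrite ?eqxx.
have T0 : 0 :: p \in T by exact: mem_head.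
have Tq : 1 :: p \in T by rewrite !inE eqxx orbT.
have v0 : vs (0 :: p) = k :: v by rewrite /vs eqxx.
exists (join ((1 :: p) :: y') (k :: v) b true T Xs); apply: (join_trace Rp hL tr).
apply/closed_under_cat; split; last (apply/closed_under_cat; split).
- do 7?split.
  + by move=> z _; exact: (join_child_call tr).
  + by move=> z /(join_child_res tr) [_]; rewrite /bs eqxx.
  + by move=> z _; exact: join_flag.
  + by move=> z _; exact: (join_child_call tr).
  + by move=> z _ /(joinP tr) [_ Ez]; apply: (join_child_arg tr Tq) => //=; rewrite [z]Ez.
  + by move=> z /(join_child_res tr) [_ Ez]; rewrite /instance /= [z]Ez; exact: join_res.
- apply/closed_pass => j z jn /(joinP tr) [_ Ez]; apply: (join_child_arg tr T0); rewrite v0 //=.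
  by rewrite size_tuple.
- apply/closed_pass => j z jn _ /(joinP tr) [_ Ez]; apply: (join_child_arg tr Tq) => //=.
  by rewrite ltnS size_tuple.
Qed.

(** Every clause has a premise, which bounds [y], and [z] occurs in a premise if it occurs
    in the conclusion. *)
Definition range_restricted (r : rule) : bool :=
  (r.1.2 != [::]) &&
  ((r.2.2 == None) || has (fun a : pattern => a.2 != None) r.1.2).

Definition ruled_by (p : tag) (rs : seq rule) :=
  all (fun r => (r.1.1 == p) && range_restricted r) rs.

Lemma pass_spec p guard n a b c r : r \in pass p guard n a b c ->
  r.1.1 = p /\ range_restricted r.
Proof.
by move=> /mapP [j _ ->]; rewrite /range_restricted has_rcons; case: guard.
Qed.

Lemma pass_ruled p guard n a b c : ruled_by p (pass p guard n a b c).
Proof. by apply/allP => r /pass_spec [-> ->]; rewrite eqxx. Qed.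

Lemma comp_ruled m n p : ruled_by p (comp_rules m n p).
Proof.
rewrite /ruled_by /= !eqxx /=; apply/allP => r /flatten_mapP [k _].
rewrite !inE => /or3P [/eqP ->|/eqP ->|/pass_spec [-> ->]]; exact/andP.
Qed.

Lemma prim_ruled n p : ruled_by p (prim_rules n p).
Proof. by rewrite /ruled_by !all_cat -!/(ruled_by p _) !pass_ruled /= !eqxx. Qed.

Lemma mu_ruled n p : ruled_by p (mu_rules n p).
Proof. by rewrite /ruled_by all_cat /= !eqxx; exact: pass_ruled. Qed.

Lemma loop_ruled n c q : ruled_by q (loop_rules n c q).
Proof. by rewrite /ruled_by !all_cat -!/(ruled_by q _) !pass_ruled /= !eqxx. Qed.


Opaque comp_rules prim_rules mu_rules loop_rules.

(** * Separation of subprograms by their tags *)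

Lemma mem_cat3 (T : eqType) (x : T) s1 s2 s3 :
  (x \in s1 ++ s2 ++ s3) = [|| x \in s1, x \in s2 | x \in s3].
Proof. by rewrite !mem_cat. Qed.

Lemma compile_spec n (f : recfun n) p r : r \in compile f p ->
  suffix p r.1.1 /\ range_restricted r.
Proof.
have own rs c q : ruled_by (c ++ q) rs -> r \in rs -> suffix q r.1.1 /\ range_restricted r.
  by move=> /allP h /h /andP [/eqP -> ->]; split=> //; exact: suffix_suffix.
have down k q : suffix (k :: q) r.1.1 /\ range_restricted r -> suffix q r.1.1 /\ range_restricted r.
  by move=> [h ->]; split=> //; apply: suffix_trans h; exact: suffix_cons.
elim: f p => {n} [n||n i|m n f IHf g IHg|n f IHf g IHg|n f IHf] p /=.
- by apply: (own _ [::]); rewrite /ruled_by /= eqxx.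
- by apply: (own _ [::]); rewrite /ruled_by /= eqxx.
- by apply: (own _ [::]); rewrite /ruled_by /= eqxx.
- rewrite mem_cat3 => /or3P [|/IHf /down //|/flatten_mapP [k _ /IHg /down //]].
  by apply: (own _ [::]); exact: comp_ruled.
- rewrite mem_cat3 => /or3P [|/IHf /down //|/IHg /down //].
  by apply: (own _ [::]); exact: prim_ruled.
rewrite mem_cat3 => /or3P [||/IHf /down //].
  by apply: (own _ [::]); exact: mu_ruled.
by apply: (own _ [:: 1]); exact: loop_ruled.
Qed.

Lemma suffix_label (k l : nat) (p q : tag) : suffix (k :: p) q -> suffix (l :: p) q -> k = l.
Proof. by move=> /suffixP [s ->] /suffix_cons_cat. Qed.

Lemma has_rulesI R p rs rs' : ruled_by p rs ->
  (forall r, r \in rs' -> r.1.1 != p) ->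
  (forall r, r.1.1 == p -> (r \in R) = (r \in rs ++ rs')) -> has_rules R p rs.
Proof.
move=> /allP hrs hrs' hR r; case: (boolP (_ == p)) => rp; rewrite ?andbT ?andbF.
  by rewrite hR // mem_cat orbC; case: (boolP (r \in rs')) => // /hrs'; rewrite rp.
by apply/negP => /hrs /andP [h _]; rewrite h in rp.
Qed.

(** The hypothesis speaks only of tags ending in [p], so it passes to the parts: by [suffix_label] a
    rule whose tag ends in [k :: p] cannot stem from a part compiled at [l :: p] with [l] different
    from [k]. *)
Lemma compile_loaded R n (f : recfun n) p :
  (forall r, suffix p r.1.1 -> (r \in R) = (r \in compile f p)) -> loaded R f p.
Proof.
have top q (r : rule) : r.1.1 == q -> suffix q r.1.1 by move=> /eqP ->; exact: suffix_refl.
have neq k q (r : rule) : suffix (k :: q) r.1.1 -> r.1.1 != q.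
  by move=> /size_suffix h; apply: contraTneq h => ->; rewrite ltnn.
have drop k q (r : rule) : suffix (k :: q) r.1.1 -> suffix q r.1.1.
  by apply: suffix_trans; exact: suffix_cons.
have skip q rs k (r : rule) : ruled_by q rs -> suffix (k :: q) r.1.1 -> r \in rs = false.
  by move=> /allP h /neq; apply: contraNF => /h /andP [].
have other m (h : recfun m) q k l (r : rule) : suffix (k :: q) r.1.1 -> k != l ->
    r \in compile h (l :: q) = false.
  move=> kr; apply: contraNF => /compile_spec [lr _].
  by rewrite (suffix_label kr lr).
elim: f p => {n} [n||n i|m n f IHf g IHg|n f IHf g IHg|n f IHf] p /=.
- move=> hR; apply: (@has_rulesI _ _ _ [::]) => [|//|r /top /hR];
    by rewrite ?cats0 /ruled_by /= ?eqxx.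
- move=> hR; apply: (@has_rulesI _ _ _ [::]) => [|//|r /top /hR];
    by rewrite ?cats0 /ruled_by /= ?eqxx.
- move=> hR; apply: (@has_rulesI _ _ _ [::]) => [|//|r /top /hR];
    by rewrite ?cats0 /ruled_by /= ?eqxx.
- move=> hR; split.
  + apply: has_rulesI (comp_ruled m n p) _ (fun r rp => hR r (top _ _ rp)) => r.
    rewrite mem_cat => /orP [/compile_spec [/neq //]|].
    by move=> /flatten_mapP [k _ /compile_spec [/neq //]].
  + apply: IHf => r pr; rewrite hR ?(drop _ _ _ pr) // mem_cat3.
    rewrite (skip _ _ _ _ (comp_ruled m n p) pr) /=.
    case: flatten_mapP => [[k _]|_]; last by rewrite orbF.
    by rewrite (other _ _ _ _ _ _ pr).
  + move=> k; apply: IHg => r pr; rewrite hR ?(drop _ _ _ pr) // mem_cat3.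
    rewrite (skip _ _ _ _ (comp_ruled m n p) pr) (other _ _ _ _ _ _ pr) //=.
    apply/flatten_mapP/idP => [[j _]|rk]; last by exists k; rewrite ?mem_enum.
    case: (eqVneq k j) => [-> //|kj]; rewrite (other _ _ _ _ _ _ pr) //.
- move=> hR; split.
  + apply: has_rulesI (prim_ruled n p) _ (fun r rp => hR r (top _ _ rp)) => r.
    by rewrite mem_cat => /orP [] /compile_spec [/neq].
  + apply: IHf => r pr; rewrite hR ?(drop _ _ _ pr) // mem_cat3.
    by rewrite (skip _ _ _ _ (prim_ruled n p) pr) /= (other _ g _ _ _ _ pr) // orbF.
  + apply: IHg => r pr; rewrite hR ?(drop _ _ _ pr) // mem_cat3.
    by rewrite (skip _ _ _ _ (prim_ruled n p) pr) /= (other _ f _ _ _ _ pr).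
move=> hR.
have lneq (r : rule) : r \in loop_rules n (0 :: p) (1 :: p) -> r.1.1 = 1 :: p.
  by move=> /(allP (loop_ruled _ _ _)) /andP [/eqP].
split.
- apply: has_rulesI (mu_ruled n p) _ (fun r rp => hR r (top _ _ rp)) => r.
  rewrite mem_cat => /orP [/lneq E|/compile_spec [/neq //]].
  by apply: (neq 1); rewrite E suffix_refl.
- apply: (@has_rulesI _ _ _ (compile f (0 :: p)) (loop_ruled _ _ _)) => [r|r /eqP rp].
    move=> /compile_spec [h _]; apply/eqP => E.
    by have := suffix_label h (top (1 :: p) r _); rewrite E eqxx => /(_ isT).
  have rq : suffix (1 :: p) r.1.1 by apply: top; rewrite rp.
  by rewrite hR ?(drop _ _ _ rq) // mem_cat3 (skip _ _ _ _ (mu_ruled n p) rq) -mem_cat.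
apply: IHf => r pr; rewrite hR ?(drop _ _ _ pr) // mem_cat3.
rewrite (skip _ _ _ _ (mu_ruled n p) pr) /=.
case: (boolP (r \in loop_rules _ _ _)) => // /lneq E.
by have := suffix_label pr (top (1 :: p) r _); rewrite E eqxx => /(_ isT).
Qed.

(** * The whole program on one input *)

Definition program (g : recfun 1) : seq rule := compile g [::].

Lemma halting_facts (g : recfun 1) n b : graph g [tuple n] b ->
  exists X : seq fact, [/\ (0, [:: [::]], 0) \in X, (3, [:: [::]], n) \in X &
    forall I, closed_at (program g) (fun a => a \in X) I].
Proof.
have Rp r : r \in program g -> r.1.2 != [::] by move=> /compile_spec [_ /andP []].
move=> hb; have lg : loaded (program g) g [::] by apply: compile_loaded.
have [X tr] := traced Rp lg [::] hb.
exists X; have [call_in arg_in] := trace_inputs tr; split=> //; first exact: (arg_in 0).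
move=> I r rR rI z; apply/premisesP => H.
(* Outside the cone of the root call nothing fires: a premise in [X] has last tag [[::]], and it
   shares its last tag with the nonempty [I]. *)
suff sI : suffix [:: [::]] I.
  by have := trace_closed tr sI rR rI z => /premisesP; apply.
case: (r.1.2) (Rp r rR) H => // a s _ /(_ a (mem_head _ _)) /(trace_cone tr).
case: (lastP I) rI => // I' c _; rewrite /instance /= -cats1 catA.
by move=> /suffix_cons_cat <-; exact: suffix_suffix.
Qed.

Lemma program_halts (g : recfun 1) n (S : fact -> Prop) N :
  (forall I, closed_at (program g) S I) ->
  (forall k I z, S (k, I, z) -> size I <= N) ->
  S (0, [:: [::]], 0) -> S (3, [:: [::]], n) ->
  exists b, graph g [tuple n] b.
Proof.
move=> Scl SN S0 Sn.
have lg : loaded (program g) g [::] by apply: compile_loaded.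
have [|b hb _] := closed_halts Scl SN lg (y := [::]) (v := [tuple n]); last by exists b.
by split=> // -[|j].
Qed.

(** * Facts as trees, clauses as formulas *)

Fixpoint num (n : nat) : H := if n is n'.+1 then HPair HBot (num n') else HBot.

(** Prolonging an identifier on the left is pairing, so [c ++ p :: y] becomes a term in the variable
    for [y], just as [d + z] does for numerals. *)
Definition encode_id (I : ident) : H :=
  foldr (fun c : tag => HPair (num (pickle c))) HBot I.

(** Not a numeral, and never the left component of a pair in the data. *)
Definition mark : H := HPair (HPair (HPair HBot HBot) HBot) HBot.

Definition mark_fact (k : nat) (t u : H) : H :=
  HPair mark (HPair (num k) (HPair t u)).

Definition encode (a : fact) : H :=
  mark_fact a.1.1 (encode_id a.1.2) (num a.2).

Definition encode_facts (X : seq fact) : H :=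
  foldr (fun a => HPair (encode a)) HBot X.

Lemma num_inj : injective num.
Proof. by elim=> [|m IH] [|n] //= [/IH ->]. Qed.

Lemma encode_id_inj : injective encode_id.
Proof.
elim=> [|c I IH] [|d J] //= [/num_inj E /IH ->].
by rewrite (pcan_inj pickleK E).
Qed.

Lemma encode_inj : injective encode.
Proof.
move=> [[k I] z] [[k' I'] z'] [/num_inj /= -> /encode_id_inj -> /num_inj ->].
by [].
Qed.

Lemma subterm_refl t : subterm t t. Proof. by case: t; left. Qed.

Lemma subterm_left t u : subterm t (HPair t u).
Proof. by right; left; exact: subterm_refl. Qed.

Lemma subterm_right t u : subterm u (HPair t u).
Proof. by right; right; exact: subterm_refl. Qed.

Lemma subterm_trans t u w : subterm t u -> subterm u w -> subterm t w.
Proof.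
move=> tu; elim: w => [|w1 IH1 w2 IH2]; case=> [<- //|] //=.
by case=> [/IH1|/IH2]; tauto.
Qed.

Lemma subterm_bot t : subterm HBot t.
Proof. by elim: t => [|t IH u _]; [left | right; left]. Qed.

Lemma subterm_dec t u : {subterm t u} + {~ subterm t u}.
Proof.
have eq_dec (a b : H) : {a = b} + {a <> b} by decide equality.
elim: u => [|u1 IH1 u2 IH2] /=; first by case: (eq_dec t HBot); tauto.
by case: (eq_dec t (HPair u1 u2)); tauto.
Qed.

Fixpoint unmarked (t : H) : Prop :=
  if t is HPair t1 t2 then [/\ t1 <> mark, unmarked t1 & unmarked t2] else True.

Lemma unmarked_subterm t u : unmarked u -> ~ subterm (HPair mark t) u.
Proof.
elim: u => [|u1 IH1 u2 IH2] /=; first by move=> _ [].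
by move=> [u1m /IH1 h1 /IH2 h2] [[/esym]|[]].
Qed.

Lemma unmarked_num n : unmarked (num n).
Proof. by elim: n. Qed.

Lemma num_mark n : num n <> mark. Proof. by case: n. Qed.

Lemma unmarked_id I : unmarked (encode_id I).
Proof. by elim: I => //= c I IH; split=> //; [exact: num_mark|exact: unmarked_num]. Qed.

Lemma id_mark I : encode_id I <> mark.
Proof. by case: I => [|c I] //= []; case: (pickle c). Qed.

(** No marked pair arises by accident: spine pairs have a coded fact on the left, and [mark],
    numerals and identifiers contain no pair with left component [mark]. *)
Lemma marked_subterm t X :
  subterm (HPair mark t) (encode_facts X) -> exists2 a, a \in X & HPair mark t = encode a.
Proof.
elim: X => [|a X IH] /=; first by case.
case=> [[]|[aX|/IH [b bX ->]]] //; last by exists b; rewrite // inE bX orbT.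
exists a; first exact: mem_head.
have um : unmarked mark by [].
have ub : unmarked (HPair (num a.1.1) (HPair (encode_id a.1.2) (num a.2))).
  split; [exact: num_mark|exact: unmarked_num|].
  by split; [exact: id_mark|exact: unmarked_id|exact: unmarked_num].
by case: aX => [//|[/(unmarked_subterm um)|/(unmarked_subterm ub)]].
Qed.

Lemma encode_subterm a X : subterm (encode a) (encode_facts X) -> a \in X.
Proof. by move=> /marked_subterm [b bX /encode_inj ->]. Qed.

Lemma subterm_encode a X : a \in X -> subterm (encode a) (encode_facts X).
Proof.
elim: X => // b X IH; rewrite inE => /predU1P [->|/IH]; last by right; right.
by right; left; exact: subterm_refl.
Qed.

Fixpoint weight (t : H) : nat :=
  if t is HPair t1 t2 then (weight t1 + weight t2).+1 else 0.

Lemma subterm_weight t u : subterm t u -> weight t <= weight u.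
Proof.
elim: u => [|u1 IH1 u2 IH2]; case=> [-> //|] //= [/IH1|/IH2] h.
  by rewrite (leq_trans h) // -addnS leq_addr.
by rewrite (leq_trans h) // -addSn leq_addl.
Qed.

(** Through this the weight of the tree [x] bounds the identifiers of all facts in it, as
    [S_bounded] asks. *)
Lemma size_encode k I z : size I <= weight (encode (k, I, z)).
Proof.
have h : size I <= weight (encode_id I).
  by elim: I => //= c I IH; rewrite ltnS (leq_trans IH) ?leq_addl.
apply: leq_trans h (subterm_weight _).
apply: subterm_trans (subterm_right _ _).
exact: subterm_trans (subterm_left _ _) (subterm_right _ _).
Qed.

Fixpoint closed_term (t : H) : term :=
  if t is HPair t1 t2 then TPair (closed_term t1) (closed_term t2) else TBot.

Lemma tval_closed s t : Defs.tval (A := term_algebra) s (closed_term t) = t.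
Proof. by elim: t => //= t -> u ->. Qed.

(** In the formulas, variables 0, 1, 2 are the tree [x], the [y] and the [z] of a clause. *)
Definition id_term (I : ident) : term :=
  foldr (fun c : tag => TPair (closed_term (num (pickle c)))) (TVar 1) I.

Definition value_term (z : option nat) : term :=
  if z is Some c then iter c (TPair TBot) (TVar 2) else TBot.

Definition pattern_term (p : tag) (a : pattern) : term :=
  TPair (closed_term mark) (TPair (closed_term (num a.1.1))
    (TPair (id_term (a.1.2 ++ [:: p])) (value_term a.2))).

Definition occurs (t : term) : form := FSub t (TVar 0).

(** The implication is written as a disjunction, since a Σ-formula admits negation only on atoms. *)
Definition rule_form (r : rule) : form :=
  foldr (fun a => FOr (FNot (occurs (pattern_term r.1.1 a))))
    (occurs (pattern_term r.1.1 r.2)) r.1.2.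

Definition initial_fact n : fact := (3, [:: [::]], n).

Definition halting_matrix (g : recfun 1) : form :=
  foldr (fun r => FAnd (rule_form r))
    (occurs (closed_term (encode (0, [:: [::]], 0)))) (program g).

Definition halting_sentence (n : nat) (phi : form) : form :=
  FEx 0 (FBall 1 (TVar 0) (FBall 2 (TVar 0)
    (FAnd (occurs (closed_term (encode (initial_fact n)))) phi))).

(** * Truth of the clauses and of the halting sentence *)

Section Semantics.
Variable s : nat -> term_algebra.

Lemma tval_id I y : s 1 = encode_id y -> Defs.tval s (id_term I) = encode_id (I ++ y).
Proof. by move=> sy; elim: I => //= c I ->; rewrite tval_closed. Qed.

Lemma tval_id_inv I J : Defs.tval s (id_term I) = encode_id J ->
  exists y, s 1 = encode_id y.
Proof.
elim: I J => [|c I IH] [|d J] //=; [by exists [::]|by exists (d :: J)|].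
by rewrite tval_closed => -[_ /IH].
Qed.

Lemma tval_value z c : s 2 = num z -> Defs.tval s (value_term (Some c)) = num (c + z).
Proof. by move=> sz; elim: c => //= c ->. Qed.

Lemma tval_value_inv z c : Defs.tval s (value_term (Some c)) = num z ->
  exists z', s 2 = num z'.
Proof.
by elim: c z => [|c IH] z /=; [exists z|case: z => [|z] //= [/IH]].
Qed.

Lemma tval_pattern p a y z : s 1 = encode_id y ->
  (a.2 = None \/ s 2 = num z) ->
  Defs.tval s (pattern_term p a) = encode (instance (p :: y) z a).
Proof.
move=> sy sz; rewrite /= !tval_closed (tval_id _ sy) -catA; congr mark_fact.
by rewrite /instance /=; case: a.2 sz => [c [//|sz]|//]; rewrite (tval_value c sz).
Qed.

(** Serves to show that ill-coded values of the variables make a clause vacuous: a premise equal to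
    a coded fact forces [y], and [z] if it occurs, to be codes. *)
Lemma tval_pattern_inv p a b : Defs.tval s (pattern_term p a) = encode b ->
  (exists y, s 1 = encode_id y) /\ (a.2 != None -> exists z, s 2 = num z).
Proof.
rewrite /= !tval_closed => -[_ /tval_id_inv [y sy] E]; split; first by exists y.
by case: a.2 E => // c /tval_value_inv.
Qed.

Lemma sat_rule r : sat s (rule_form r) <->
  ((forall a, a \in r.1.2 -> subterm (Defs.tval s (pattern_term r.1.1 a)) (s 0)) ->
   subterm (Defs.tval s (pattern_term r.1.1 r.2)) (s 0)).
Proof.
case: r => [[p prems] concl]; rewrite /rule_form; cbn [fst snd].
elim: prems => [|a prems IH]; first by split=> [h _|]; [exact: h|apply].
split=> [[na|/IH h] H|H].
- by case: na; apply: H; exact: mem_head.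
- by apply: h => b bp; apply: H; rewrite inE bp orbT.
case: (subterm_dec (Defs.tval s (pattern_term p a)) (s 0)) => ha; last by left.
right; apply/IH => h; apply: H => b; rewrite inE => /predU1P [->|/h] //.
Qed.

Lemma sat_matrix g : sat s (halting_matrix g) <->
  subterm (encode (0, [:: [::]], 0)) (s 0) /\
  forall r, r \in program g -> sat s (rule_form r).
Proof.
rewrite /halting_matrix; elim: (program g) => [|r rs IH].
  by rewrite /occurs; cbn [foldr sat]; rewrite tval_closed; split=> [//|[]].
split=> [[hr /IH [h0 hrs]]|[h0 h]].
  by split=> // r'; rewrite inE => /predU1P [->|/hrs].
split; first exact/h/mem_head.
by apply/IH; split=> // r' rr'; apply: h; rewrite inE rr' orbT.
Qed.

End Semantics.

Lemma subterm_id I J : subterm (encode_id J) (encode_id (I ++ J)).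
Proof.
elim: I => [|c I IH]; first exact: subterm_refl.
exact: subterm_trans IH (subterm_right _ _).
Qed.

Lemma subterm_num c z : subterm (num z) (num (c + z)).
Proof.
elim: c => [|c IH]; first exact: subterm_refl.
exact: subterm_trans IH (subterm_right _ _).
Qed.

Lemma subterm_encode_id a : subterm (encode_id a.1.2) (encode a).
Proof.
apply: subterm_trans (subterm_right _ _); apply: subterm_trans (subterm_right _ _).
exact: subterm_left.
Qed.

Lemma subterm_encode_val a : subterm (num a.2) (encode a).
Proof. by do 3![apply: subterm_trans (subterm_right _ _)]; exact: subterm_refl. Qed.

(** From a witness [x], the facts coded by subterms of [x] form a closed set with identifiers
    bounded by the weight of [x], so the program halts. Conversely the list of facts of a finite
    trace serves as [x]. *)
Lemma halting_sentence_true g n :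
  true_in term_algebra (halting_sentence n (halting_matrix g)) <->
  exists b, graph g [tuple n] b.
Proof.
split=> [/(_ (fun=> HBot)) [x hx]|[b /halting_facts [X [X0 Xn Xcl]]] s].
  pose s y z := update (update (update (A := term_algebra) (fun=> HBot) 0 x) 1 y) 2 z.
  have {}hx y z : subterm y x -> subterm z x ->
      subterm (encode (initial_fact n)) x /\ sat (s y z) (halting_matrix g).
    move=> yx zx; have [] := hx y yx z zx.
    by rewrite /occurs; cbn [sat]; rewrite tval_closed.
  (* [HBot] is a subterm of every tree, so the bounded quantifiers have an instance, which yields
     the two initial facts. *)
  have [hn /sat_matrix [h0 _]] := hx _ _ (subterm_bot x) (subterm_bot x).
  apply: (@program_halts g n (fun a => subterm (encode a) x) (weight x)) => //.
  - move=> [//|p y] r rR [rp] z; apply/premisesP => H.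
    have [_ rr] := compile_spec rR; move/andP: rr => [prems safe].
    have [a ar] : exists a, a \in r.1.2.
      by case: (r.1.2) prems => // a ? _; exists a; exact: mem_head.
    have yx : subterm (encode_id y) x.
      apply: subterm_trans (H a ar); apply: subterm_trans (subterm_encode_id _).
      by rewrite /= -cat_rcons; exact: subterm_id.
    (* Closure concerns every [z], the quantifier only those in [x]. A premise with [z] puts [num z]
       into [x]; if there is none, range restriction frees the conclusion of [z] as well and 0 takes
       its place. *)
    have [z' zx same] : exists2 z', subterm (num z') x &
        forall a, a \in r.2 :: r.1.2 -> instance (p :: y) z a = instance (p :: y) z' a.
      case: (boolP (has (fun a : pattern => a.2 != None) r.1.2)) safe;
        [move=> /hasP [c cr cz] _|move=> /hasPn none].
        exists z => //; apply: subterm_trans (H c cr).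
        apply: subterm_trans (subterm_encode_val _).
        by rewrite /instance /=; case: c.2 cz => // d _; exact: subterm_num.
      rewrite orbF => rn; exists 0; first exact: subterm_bot.
      move=> c; rewrite inE /instance => /predU1P [->|/none]; first by rewrite (eqP rn).
      by rewrite negbK => /eqP ->.
    have [_ /sat_matrix [_ /(_ r rR) /sat_rule hr]] := hx _ _ yx zx.
    rewrite same ?mem_head // -(@tval_pattern (s (encode_id y) (num z'))) //; last by right.
    rewrite rp; apply: hr => c cr.
    rewrite (@tval_pattern _ _ _ y z') //; last by right.
    by rewrite -rp -same ?inE ?cr ?orbT //; apply: H.
  - by move=> k I z /subterm_weight; apply: leq_trans; exact: size_encode.
exists (encode_facts X) => y _ z _.
set t := update _ 2 z; have t0 : t 0 = encode_facts X by [].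
split; first by rewrite /occurs; cbn [sat]; rewrite tval_closed; exact: subterm_encode.
apply/sat_matrix; rewrite t0; split; first exact: subterm_encode.
move=> r rR; apply/sat_rule; rewrite t0 => H.
have [_ rr] := compile_spec rR; move/andP: rr => [prems safe].
have inv a : a \in r.1.2 -> (exists y', t 1 = encode_id y') /\
    (a.2 != None -> exists z', t 2 = num z').
  by move=> /H; rewrite [Defs.tval _ _]/= => /marked_subterm [c _]; exact: tval_pattern_inv.
have [y' ty] : exists y', t 1 = encode_id y'.
  by case: (r.1.2) prems inv => // a ? _ /(_ a (mem_head _ _)) [].
have [z' tz] : exists z', forall a, a \in r.2 :: r.1.2 -> a.2 = None \/ t 2 = num z'.
  case: (boolP (has (fun a : pattern => a.2 != None) r.1.2)) safe;
    [move=> /hasP [c cr cz] _|move=> /hasPn none].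
    by have [_ /(_ cz) [z' tz]] := inv c cr; exists z' => a _; right.
  rewrite orbF => rn; exists 0 => a; rewrite inE => /predU1P [->|/none]; left; first exact/eqP.
  by apply/eqP; rewrite -[_ == _]negbK.
rewrite (tval_pattern _ ty (tz _ (mem_head _ _))).
apply: subterm_encode.
have /premisesP := Xcl (r.1.1 :: y') r rR erefl z'; apply=> a ar.
by apply: encode_subterm; rewrite -(@tval_pattern t) //; [exact: H|apply: tz; rewrite inE ar orbT].
Qed.

(** * Recursiveness of the diagonal function *)

Lemma graph_functional n (f : recfun n) v b c : graph f v b -> graph f v c -> b = c.
Proof.
elim: f v b c => {n} [n||n i|m n f IHf g IHg|n f IHf g IHg|n f IHf] v b c /=.
- by move=> -> ->.
- by move=> -> ->.
- by move=> -> ->.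
- move=> [w gw fw] [w' gw' fw']; suff E : w = w' by apply: IHf fw _; rewrite E.
  by apply: eq_from_tnth => i; exact: IHg (gw i) (gw' i).
- elim: (thead v) b c => [|k IHk] b c /=; first exact: IHf.
  by move=> [d hd gd] [d' /(IHk _ _ hd) <- gd']; exact: IHg gd gd'.
move=> [fb lb] [fc lc]; case: (ltngtP b c) => [/lc|/lb|] // [d].
  by move=> /(IHf _ _ _ fb).
by move=> /(IHf _ _ _ fc).
Qed.

Definition computable n (F : seq nat -> nat) : Prop :=
  exists f : recfun n, forall v b, graph f v b <-> b = F v.

Lemma computable_proj n i : i < n -> computable n (fun v => nth 0 v i).
Proof.
move=> ni; exists (RProj (Ordinal ni)) => v b /=.
by rewrite (tnth_nth 0).
Qed.

Lemma computable_comp m n F (G : nat -> seq nat -> nat) : computable m F ->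
  (forall i, i < m -> computable n (G i)) ->
  computable n (fun v => F [seq G i v | i <- iota 0 m]).
Proof.
move=> [f hf] hG; have /fin_all_exists [g hg] : forall i : 'I_m, exists g : recfun n,
    forall v b, graph g v b <-> b = G i v by move=> i; exact: hG.
exists (RComp f g) => v b /=.
have Gv : [tuple G i v | i < m] = [seq G i v | i <- iota 0 m] :> seq nat.
  by rewrite /= -val_enum_ord -map_comp.
split=> [[w gw /hf ->]|->].
  congr F; rewrite -Gv; congr val; apply: eq_from_tnth => i.
  by rewrite tnth_mktuple; apply/hg/gw.
exists [tuple G i v | i < m] => [i|]; last by apply/hf; rewrite Gv.
by apply/hg; rewrite tnth_mktuple.
Qed.

Lemma computable_succ n F : computable n F -> computable n (fun v => (F v).+1).
Proof.
move=> hF; apply: (@computable_comp 1 n (fun v => (nth 0 v 0).+1) (fun=> F)) => //.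
by exists RSucc => v b /=; rewrite /thead (tnth_nth 0).
Qed.

Lemma computable_const n c : computable n (fun=> c).
Proof. by elim: c => [|c]; [exists (RZero n)|exact: computable_succ]. Qed.

Lemma computable_op n (op : nat -> nat -> nat) F G :
  computable 2 (fun v => op (nth 0 v 0) (nth 0 v 1)) ->
  computable n F -> computable n G -> computable n (fun v => op (F v) (G v)).
Proof.
move=> hop hF hG.
apply: (@computable_comp 2 n (fun v => op (nth 0 v 0) (nth 0 v 1)) (nth F [:: F; G])) => //.
by case=> [|[|i]].
Qed.

Lemma computable_prim n F G : computable n F -> computable n.+2 G ->
  computable n.+1 (fun v =>
    iteri (head 0 v) (fun k r => G [:: k, r & behead v]) (F (behead v))).
Proof.
move=> [f hf] [g hg]; exists (RPrim f g) => v; case/tupleP: v => k v b.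
rewrite -[graph _ _ b]/(prim_graph (graph f) (graph g)
  [tuple of behead [tuple of k :: v]] (thead [tuple of k :: v]) b) theadE.
have -> : [tuple of behead [tuple of k :: v]] = v by exact: val_inj.
elim: k b => [|k IH] b /=; first by rewrite hf.
split=> [[c hc hb]|->]; first by rewrite ((hg _ _).1 hb) /= ((IH _).1 hc).
by eexists; [exact: (IH _).2|exact: (hg _ _).2].
Qed.

Lemma computable_add : computable 2 (fun v => nth 0 v 0 + nth 0 v 1).
Proof.
have [f hf] := computable_prim (computable_proj (ltn0Sn 0))
  (computable_succ (computable_proj (isT : 1 < 3))).
exists f => v b; rewrite hf; case/tupleP: v => k v /=.
suff -> : iteri k (fun _ r => r.+1) (nth 0 v 0) = k + nth 0 v 0 by [].
by elim: k => //= k ->.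
Qed.

(** Triangular numbers, by the recursion inside the Cantor pairing, so that [cpairE] holds by
    computation. *)
Definition triangle k := iteri k (fun i r => i.+1 + r) 0.

Lemma computable_triangle : computable 1 (fun v => triangle (nth 0 v 0)).
Proof.
have [f hf] := computable_prim (computable_const 0 0) (computable_op computable_add
  (computable_succ (computable_proj (isT : 0 < 2))) (computable_proj (isT : 1 < 2))).
by exists f => v b; rewrite hf; case/tupleP: v.
Qed.

Lemma cpairE m n : cpair m n = n + triangle (n + m).
Proof. by []. Qed.

Lemma computable_cpair n F G : computable n F -> computable n G ->
  computable n (fun v => cpair (F v) (G v)).
Proof.
apply: computable_op.
have h0 := computable_proj (isT : 0 < 2); have h1 := computable_proj (isT : 1 < 2).
have [f hf] := computable_op computable_add h1 (computable_comp computable_triangle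
  (fun i (_ : i < 1) => computable_op computable_add h1 h0)).
by exists f => v b; rewrite hf cpairE.
Qed.

Lemma computable_num :
  computable 1 (fun v => tcode (closed_term (num (nth 0 v 0)))).
Proof.
have [f hf] := computable_prim (computable_const 0 (tcode TBot))
  (computable_cpair (computable_const 2 2)
    (computable_cpair (computable_const 2 (tcode TBot)) (computable_proj (isT : 1 < 2)))).
exists f => v b; rewrite hf; case/tupleP: v => k v /=.
suff -> : iteri k (fun _ r => cpair 2 (cpair (cpair 1 0) r)) (cpair 1 0) =
  tcode (closed_term (num k)) by [].
by elim: k => //= k ->.
Qed.

(** Depends on the matrix only through its code [e], hence is arithmetical; 6, 7, 5 and 3 are the
    codes of [FEx], [FAll], [FImp] and [FAnd]. *)
Definition sentence_code (n e : nat) : nat :=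
  cpair 6 (cpair 0 (cpair 7 (cpair 1 (cpair 5 (cpair (fcode (FSub (TVar 1) (TVar 0)))
    (cpair 7 (cpair 2 (cpair 5 (cpair (fcode (FSub (TVar 2) (TVar 0)))
      (cpair 3 (cpair (fcode (occurs (closed_term (encode (initial_fact n))))) e))))))))))).

Lemma sentence_codeE n phi : fcode (halting_sentence n phi) = sentence_code n (fcode phi).
Proof. by []. Qed.

Lemma computable_diagonal :
  computable 1 (fun v => sentence_code (nth 0 v 0) (nth 0 v 0)).
Proof.
have c k := computable_const 1 k.
have p : computable 1 (fun v => nth 0 v 0) by exact: computable_proj.
rewrite /sentence_code; cbn [fcode tcode occurs closed_term encode mark_fact initial_fact fst snd].
by repeat first [exact: c | exact: p | exact: computable_num | apply: computable_cpair].
Qed.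

(** * Shape of the sentences and the diagonal argument *)

Lemma sigma_matrix g : Sigma 0 0 0 (halting_matrix g).
Proof.
rewrite /halting_matrix; elim: (program g) => [|r rs IH]; first exact: Sigma_sub.
apply: (@Sigma_and 0 0 0 0 0 0) IH.
rewrite /rule_form; elim: r.1.2 => [|a s IH]; first exact: Sigma_sub.
exact: (@Sigma_or 0 0 0 0 0 0) (Sigma_nsub _ _) IH.
Qed.

Lemma quantifier_free_matrix g : quantifier_free (halting_matrix g).
Proof.
rewrite /halting_matrix; elim: (program g) => //= r rs ->; rewrite andbT.
by rewrite /rule_form; elim: r.1.2.
Qed.

Lemma closed_term_vars t : tvars (closed_term t) = [::].
Proof. by elim: t => //= t -> u ->. Qed.

Lemma occurs_vars p a : all (fun x => x < 3) (free_vars (occurs (pattern_term p a))).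
Proof.
rewrite /= !closed_term_vars /= !all_cat /= andbT; apply/andP; split.
  by elim: (_ ++ _) => //= c I; rewrite all_cat closed_term_vars.
by case: a.2 => // c; elim: c.
Qed.

Lemma matrix_vars g : all (fun x => x < 3) (free_vars (halting_matrix g)).
Proof.
rewrite /halting_matrix; elim: (program g) => [|r rs IH].
  rewrite /occurs; cbn [foldr free_vars]; by rewrite closed_term_vars.
rewrite [free_vars _]/= all_cat {}IH andbT /rule_form.
elim: r.1.2 => [|a s IH]; first exact: occurs_vars.
by rewrite [free_vars _]/= all_cat {}IH andbT; exact: occurs_vars.
Qed.

Lemma ex_ball_ball_sentence n g : ex_ball_ball (halting_sentence n (halting_matrix g)).
Proof.
split.
- apply/Sigma_ex/Sigma_ball => //; apply: Sigma_ball => //.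
  exact: (@Sigma_and 0 0 0 0 0 0) (Sigma_sub _ _) (sigma_matrix g).
- rewrite /sentence /halting_sentence.
  move: (closed_term _) (closed_term_vars (encode (initial_fact n))) => t tn.
  have := matrix_vars g; move: (halting_matrix g) => phi /allP hphi.
  rewrite /= tn /= -!filter_predI.
  apply/eqP; rewrite -[_ == _]negbK -has_filter; apply/hasPn => x /hphi.
  by case: x => [|[|[|x]]].
- exists 0, 1, 2, (FAnd (occurs (closed_term (encode (initial_fact n)))) (halting_matrix g)).
  by split=> //; exact: quantifier_free_matrix.
Qed.

(** On input [e], the function [g] asks [f] about the sentence with input [e] and matrix coded by
    [e], and halts exactly when [f] outputs 0. For [e] the code of the matrix of [g], that sentence
    says that [g] halts on [e], so [f] errs. *)
Lemma no_decision f : ~ decides_on f (codes ex_ball_ball) (codes (true_in term_algebra)).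
Proof.
move=> hf; have [d hd] := computable_diagonal.
(* The search value is a dummy: the projection with index 1 picks the input, so the search stops at
   once or never. *)
pose g := RMu (RComp f (fun=> RComp d (fun=> RProj (@Ordinal 2 1 isT)))).
pose phi := halting_matrix g; have [e eE] : exists e, e = fcode phi by exists (fcode phi).
pose psi := halting_sentence e phi.
have [c cE] : exists c, c = sentence_code e e by exists (sentence_code e e).
have psiE : fcode psi = c by rewrite sentence_codeE -eE cE.
have gE k b : graph (RComp f (fun=> RComp d (fun=> RProj (@Ordinal 2 1 isT)))) [tuple k; e] b <->
    graph f [tuple c] b.
  have dE u : graph d [tuple e] u <-> u = c by rewrite hd cE.
  have projE u : graph (RProj (@Ordinal 2 1 isT)) [tuple k; e] u <-> u = e by [].
  split=> [[w hw fw]|fw].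
    suff E : w = [tuple c] by rewrite -E.
    apply: eq_from_tnth => i; rewrite ord1.
    have [u hu du] := hw ord0; apply/dE.
    suff E : u = [tuple e] by rewrite -E.
    by apply: eq_from_tnth => j; rewrite ord1; apply/projE/hu.
  exists [tuple c] => // i; exists [tuple e] => [j|].
    by apply/projE; rewrite ord1.
  by apply/dE; rewrite ord1.
have codeP : codes (true_in term_algebra) c <-> true_in term_algebra psi.
  by rewrite -psiE; split=> [[q hq /fcode_inj ->] //|tpsi]; exists psi.
have haltE : true_in term_algebra psi <-> exists b, graph g [tuple e] b.
  exact: halting_sentence_true.
have [|b hb hbP] := hf c; first by exists psi; [exact: ex_ball_ball_sentence|].
(* Answer 1 would make [g] halt, hence [f] output 0 as well; answer 0 makes [g] halt although the
   sentence is judged false. *)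
move: hbP; rewrite codeP haltE; case: b hb => hb hbP.
  have [k [/gE h0 _]] : exists b, graph g [tuple e] b by apply/hbP.
  by have := graph_functional hb h0.
suff /hbP : exists b, graph g [tuple e] b by [].
by exists 0; split=> //; apply/gE.
Qed.

Theorem theorem1 :
  ~ recursive (codes (Sigma_true term_algebra 1 0 2)) /\
  ~ (exists f : recfun 1,
       decides_on f (codes ex_ball_ball) (codes (true_in term_algebra))).
Proof.
split=> [[f hf]|[f]]; last exact: no_decision.
(* On codes of [ex_ball_ball] sentences, membership in [Sigma_true] amounts to truth, so the same
   [f] would decide truth there. *)
apply: (@no_decision f) => n [phi [sig sen _] ->].
have [b hb hP] := hf (fcode phi) I; exists b => //; rewrite -hP.
split=> [[psi tpsi /fcode_inj E]|[psi [_ _ tpsi] E]]; last by exists psi.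
by exists phi => //; split=> //; rewrite E.
Qed.
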